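(* Let $[B_{\mathcal J}\mid M]$ be a non-degenerate Grothendieck matched pair of algebras. The assignment $X\mapsto B\wedge X$ is the action on objects of a full and faithful functor $$B\wedge(-)\colon[B_{\mathcal J}\mid M]\text{-}\mathcal{S}et\to[B_{\mathcal J}\mid M]\text{-}\mathcal{S}hv$$ from the category of $[B_{\mathcal J}\mid M]$-sets to the category of $[B_{\mathcal J}\mid M]$-sheaves, which exhibits $[B_{\mathcal J}\mid M]\text{-}\mathcal{S}et$ as equivalent to the two-valued collapse of $[B_{\mathcal J}\mid M]\text{-}\mathcal{S}hv$.
   Context: Boolean algebras have complement $b'$ and are non-degenerate if $0\neq1$. For $P\subseteq B$ write $P^-=P\setminus\{0\}$. A partition of $b\in B$ is a subset $P\subseteq B\setminus\{0\}$ with $\bigvee P=b$ and $c\wedge d=0$ for $c\ne d$ in $P$; ''partition'' alone means partition of $1$. A zero-dimensional topology on $B$ is a collection $\mathcal J$ of partitions containing every finite partition and such that: (i) if $P\in\mathcal J$ and $Q_b\in\mathcal J$ for each $b\in P$, then $\{b\wedge c:b\in P,c\in Q_b\}^-\in\mathcal J$; (ii) if $P\in\mathcal J$ and $\alpha\colon P\to I$ is surjective, then each $\bigvee\alpha^{-1}(i)$ exists and $\{\bigvee\alpha^{-1}(i):i\in I\}\in\mathcal J$. A Grothendieck Boolean algebra $B_{\mathcal J}$ is a Boolean algebra with such a topology; a homomorphism $f\colon B_{\mathcal J}\to C_{\mathcal K}$ is a Boolean homomorphism with $f(P)^-\in\mathcal K$ for all $P\in\mathcal J$. $\mathcal J_b$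 is the set of partitions $P$ of $b$ contained in some $Q\in\mathcal J$. A $B_{\mathcal J}$-set is a set $X$ with an operation $(b,x,y)\mapsto b(x,y)$, $B\times X\times X\to X$, satisfying $b(x,x)=x$, $b(b(x,y),z)=b(x,z)$, $b(x,b(y,z))=b(x,z)$, $1(x,y)=x$, $b'(x,y)=b(y,x)$, $(b\wedge c)(x,y)=b(c(x,y),y)$, together with, for each infinite $P\in\mathcal J$, a function $P\colon X^P\to X$ with $P(\lambda b.x)=x$, $P(\lambda b.\,b(x_b,y_b))=P(\lambda b.\,x_b)$, $b(P(x),x_b)=x_b$ for $b\in P$. Write $x\equiv_by$ iff $b(x,y)=y$. These equivalence relations determine the structure; equivalently a $B_{\mathcal J}$-set is a set with equivalence relations $\equiv_b$ ($b\in B$), $\equiv_0$ being total, such that $x\equiv_by$, $c\leqslant b$ imply $x\equiv_cy$, and for all $P\in\mathcal J$, $x\in X^P$ there is a unique $z$ with $z\equiv_bx_b$ for all $b\in P$. Homomorphisms are functions preserving each $\equiv_b$. A (non-degenerate) Grothendieck matched pair $[B_{\mathcal J}\mid M]$ is a non-degenerate Grothendieck Boolean algebra $B_{\mathcal J}$, a monoid $M$, a $B_{\mathcal J}$-set structure on $M$, and a left action $(m,b)\mapsto m^*b$ of $M$ on $B_{\mathcal J}$ by Grothendieck Boolean homomorphisms, with: $m\equiv_bn\Rightarrow mp\equiv_bnp$; $n\equiv_bp\Rightarrow mn\equiv_{m^*b}mp$; $m\equiv_bn\Rightarrow b\wedge m^*c=b\wedge n^*c$. A $[B_{\mathcal J}\mid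 M]$-set is a set $X$ with $B_{\mathcal J}$-set and left $M$-set structures such that $m\equiv_bn\Rightarrow m\cdot x\equiv_bn\cdot x$ and $x\equiv_by\Rightarrow m\cdot x\equiv_{m^*b}m\cdot y$. Homomorphisms preserve both structures. A $[B_{\mathcal J}\mid M]$-presheaf $X$ comprises sets $X(b)$ for $b\in B\setminus\{0\}$, functions $m\cdot(-)\colon X(c)\to X(m^*c)$ whenever $m^*c\neq0$, and functions $b\wedge(-)\colon X(c)\to X(b\wedge c)$ whenever $b\wedge c\neq0$, such that for $x\in X(c)$ and all $a,b\in B$, $m,n\in M$ for which the terms are defined: $c\wedge x=x$, $(a\wedge b)\wedge x=a\wedge(b\wedge x)$; $1\cdot x=x$, $(mn)\cdot x=m\cdot(n\cdot x)$; $m\cdot(b\wedge x)=(m^*b)\wedge(m\cdot x)$; and if $m\equiv_bn$ then $b\wedge(m\cdot x)=b\wedge(n\cdot x)$. It is a $[B_{\mathcal J}\mid M]$-sheaf if for each $c\neq0$, $P\in\mathcal J_c$ and $x\in\prod_{b\in P}X(b)$ there is given $P(x)\in X(c)$, with $b\wedge P(x)=x_b$ for all $b\in P$, and $P(\lambda b.\,b\wedge x)=x$ for all $x\in X(c)$. Homomorphisms are families of functions $f_c\colon X(c)\to Y(c)$ preserving all $m\cdot(-)$ and $b\wedge(-)$. For a $[B_{\mathcal J}\mid M]$-set $X$, the sheaf $B\wedge X$ has $(B\wedge X)(b)=X/{\equiv_b}$, whose elements are written $b\wedge x$ ($x\in X$), with $b\wedge(c\wedge x)=(b\wedge c)\wedge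 x$ and $m\cdot(c\wedge x)=(m^*c)\wedge(m\cdot x)$. On morphisms, $(B\wedge f)(b\wedge x)=b\wedge f(x)$. The two-valued collapse $\mathcal E_{\mathrm{tv}}$ of a cartesian closed category $\mathcal E$ is the full subcategory of objects $X$ that are either initial or well-supported (i.e. the unique map $X\to1$ is an epimorphism). *)

(* Defs.v *)
(* MathComp order theory and classical sets.  Sets are types, and the library's
   choice and extensionality principles are available throughout. *)
From mathcomp Require Import all_boot all_order.
From mathcomp Require Import boolp classical_sets functions cardinality.

Set Implicit Arguments.
Unset Strict Implicit.
Unset Printing Implicit Defensive.

Import Order.Theory.
Local Open Scope order_scope.
Local Obligation Tactic := idtac.

Record category := Category {
  ob :> Type;
  hom : ob -> ob -> Type;
  idm : forall x, hom x x;
  comp : forall x y z, hom y z -> hom x y -> hom x z;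
  comp1m : forall x y (f : hom x y), comp (idm y) f = f;
  compm1 : forall x y (f : hom x y), comp f (idm x) = f;
  compA : forall x y z t (h : hom z t) (g : hom y z) (f : hom x y),
    comp h (comp g f) = comp (comp h g) f }.
Arguments hom {c} x y.
Arguments idm {c} x.
Arguments comp {c x y z} g f.

Record functor (C D : category) := Functor {
  fobj :> C -> D;
  fmap : forall x y : C, hom x y -> hom (fobj x) (fobj y);
  fmap1 : forall x : C, fmap (idm x) = idm (fobj x);
  fmapM : forall (x y z : C) (g : hom y z) (f : hom x y),
    fmap (comp g f) = comp (fmap g) (fmap f) }.
Arguments fmap {C D} f0 {x y} f : rename.

Definition id_functor (C : category) : functor C C :=
  @Functor C C id (fun _ _ f => f) (fun _ => erefl) (fun _ _ _ _ _ => erefl).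

Program Definition comp_functor (C D E : category)
    (G : functor D E) (F : functor C D) : functor C E :=
  @Functor C E (fun x => G (F x)) (fun _ _ f => fmap G (fmap F f)) _ _.
Next Obligation. by move=> * /=; rewrite !fmap1. Qed.
Next Obligation. by move=> * /=; rewrite !fmapM. Qed.

Definition full (C D : category) (F : functor C D) :=
  forall (x y : C) (g : hom (F x) (F y)), exists f : hom x y, fmap F f = g.

Definition faithful (C D : category) (F : functor C D) :=
  forall (x y : C) (f g : hom x y), fmap F f = fmap F g -> f = g.

Definition is_iso (C : category) (x y : C) (f : hom x y) :=
  exists g : hom y x, comp g f = idm x /\ comp f g = idm y.

Definition nat_isomorphic (C D : category) (F G : functor C D) :=
  exists eta : forall x, hom (F x) (G x),
    (forall (x y : C) (f : hom x y),
       comp (eta y) (fmap F f) = comp (fmap G f) (eta x)) /\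
    (forall x, is_iso (eta x)).

Definition is_equivalence (C D : category) (F : functor C D) :=
  exists G : functor D C,
    nat_isomorphic (comp_functor G F) (id_functor C) /\
    nat_isomorphic (comp_functor F G) (id_functor D).

Definition full_subcategory (C : category) (A : C -> Prop) : category :=
  @Category {x : C | A x} (fun x y => hom (sval x) (sval y))
    (fun x => idm (sval x)) (fun _ _ _ g f => comp g f)
    (fun _ _ f => comp1m f) (fun _ _ f => compm1 f)
    (fun _ _ _ _ h g f => compA h g f).

Definition corestrict (C D : category) (F : functor C D) (A : D -> Prop)
    (FA : forall x, A (F x)) : functor C (full_subcategory A) :=
  @Functor C (full_subcategory A) (fun x => exist A (F x) (FA x))
    (fun _ _ f => fmap F f) (fmap1 F) (fmapM F).

Definition is_initial (C : category) (x : C) :=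
  forall y, exists f : hom x y, forall g, g = f.

Definition is_epi (C : category) (x y : C) (f : hom x y) :=
  forall z (g h : hom y z), comp g f = comp h f -> g = h.

Record terminal_object (C : category) := TerminalObject {
  one :> C;
  to_one : forall x, hom x one;
  to_one_unique : forall x (f : hom x one), f = to_one x }.

Definition well_supported (C : category) (t : terminal_object C) (x : C) :=
  is_epi (to_one t x).

Definition two_valued (C : category) (t : terminal_object C) (x : C) :=
  is_initial x \/ well_supported t x.

Definition two_valued_collapse (C : category) (t : terminal_object C) :=
  full_subcategory (@two_valued C t).

Section Topology.
Context {d : Order.disp_t} {B : ctbDistrLatticeType d}.
Implicit Types (P Q : set B) (a b c : B).

Definition partition_of P b :=
  [/\ forall c, P c -> c != \bot,
      supremums P b &
      forall c e, P c -> P e -> c <> e -> c `&` e = \bot].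

Definition minus0 P : set B := [set b | P b /\ b != \bot]%classic.

Definition refinement P (Q : B -> set B) : set B :=
  [set a | exists b, exists2 c, P b /\ Q b c & a = (b `&` c)%O]%classic.

Record zd_topology := ZDTopology {
  zd_cov :> set B -> Prop;
  zd_part : forall P, zd_cov P -> partition_of P \top;
  zd_fin : forall P, partition_of P \top -> finite_set P -> zd_cov P;
  zd_refine : forall P (Q : B -> set B), zd_cov P ->
    (forall b, P b -> zd_cov (Q b)) ->
    zd_cov (minus0 (refinement P Q));
  zd_coarsen : forall P (I : Type) (alpha : P -> I), zd_cov P ->
    (forall i, exists p, alpha p = i) ->
    exists s : I -> B,
      (forall i,
         supremums [set b | exists2 p : P, alpha p = i & b = val p]%classic (s i)) /\
      zd_cov (range s) }.

Definition local_cov (J : zd_topology) b P :=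
  partition_of P b /\ exists2 Q, J Q & (P `<=` Q)%classic.

Definition boolean_hom (f : B -> B) :=
  [/\ f \bot = \bot /\ f \top = \top,
      forall b c, f (b `&` c) = f b `&` f c,
      forall b c, f (b `|` c) = f b `|` f c &
      forall b, f (~` b) = ~` f b].

Definition grothendieck_hom (J : zd_topology) (f : B -> B) :=
  boolean_hom f /\ forall P, J P -> J (minus0 (f @` P)%classic).

(* [bs_ite b x y] is the operation b(x,y), read "if b then x else y";
   [bs_glue] is the family of operations P : X^P -> X for infinite P. *)
Record bset (J : zd_topology) (X : Type) := BSet {
  bs_ite : B -> X -> X -> X;
  bs_itexx : forall b x, bs_ite b x x = x;
  bs_itel : forall b x y z, bs_ite b (bs_ite b x y) z = bs_ite b x z;
  bs_iter : forall b x y z, bs_ite b x (bs_ite b y z) = bs_ite b x z;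
  bs_ite1 : forall x y, bs_ite \top x y = x;
  bs_iteC : forall b x y, bs_ite (~` b) x y = bs_ite b y x;
  bs_iteI : forall b c x y, bs_ite (b `&` c) x y = bs_ite b (bs_ite c x y) y;
  bs_glue : forall P, J P -> infinite_set P -> (P -> X) -> X;
  bs_glue_cst : forall P (JP : J P) (Pinf : infinite_set P) x,
    bs_glue JP Pinf (fun=> x) = x;
  bs_glue_ite : forall P (JP : J P) (Pinf : infinite_set P) (x y : P -> X),
    bs_glue JP Pinf (fun p => bs_ite (val p) (x p) (y p)) = bs_glue JP Pinf x;
  bs_ite_glue : forall P (JP : J P) (Pinf : infinite_set P) (x : P -> X) (p : P),
    bs_ite (val p) (bs_glue JP Pinf x) (x p) = x p }.

Definition beq (J : zd_topology) (X : Type) (S : bset J X) b (x y : X) :=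
  bs_ite S b x y = y.

Section BSetTheory.
Variables (J : zd_topology) (X : Type) (S : bset J X).
Implicit Types x y z : X.

Lemma beq_refl b x : beq S b x x. Proof. exact: bs_itexx. Qed.

Lemma beq_sym b x y : beq S b x y -> beq S b y x.
Proof. by rewrite /beq => <-; rewrite bs_itel bs_itexx. Qed.

Lemma beq_trans b x y z : beq S b x y -> beq S b y z -> beq S b x z.
Proof. by rewrite /beq => xy yz; rewrite -(bs_itel S b x y z) xy. Qed.

Lemma beq_le b c x y : c <= b -> beq S b x y -> beq S c x y.
Proof. by move=> /meet_idPl cb; rewrite /beq -{1}cb bs_iteI => ->; rewrite bs_itexx. Qed.

Lemma beq_iteT b x y : beq S b (bs_ite S b x y) x.
Proof. by rewrite /beq bs_itel bs_itexx. Qed.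

Lemma beq_iteF b x y : beq S (~` b) (bs_ite S b x y) y.
Proof. by rewrite /beq bs_iteC bs_iter bs_itexx. Qed.

Lemma beq1 x y : beq S \top x y -> x = y.
Proof. by rewrite /beq bs_ite1. Qed.

Lemma beq0 x y : beq S \bot x y.
Proof. by rewrite /beq -compl1 bs_iteC bs_ite1. Qed.

Lemma beqU b c x y : beq S b x y -> beq S c x y -> beq S (b `|` c) x y.
Proof.
rewrite /beq => bxy cxy.
by rewrite -[b `|` c]complK complU bs_iteC bs_iteI !bs_iteC cxy.
Qed.

Lemma bset_glue_unique P x y : J P -> (forall b, P b -> beq S b x y) -> x = y.
Proof.
move=> JP xy; case: (pselect (finite_set P)) => [/finite_seqP[s Ps]|Pinf].
  have [_ [ub lub] _] := zd_part JP.
  have xyb b : b \in s -> beq S b x y by move=> bs; apply: xy; rewrite Ps.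
  apply: beq1; apply: (@beq_le (\join_(b <- s) b)).
    by apply: lub => c; rewrite Ps => /= cs; apply: (@joins_sup_seq _ _ _ s predT id c).
  elim: s xyb {Ps} => [|b s IH] xyb; first by rewrite big_nil; apply: beq0.
  rewrite big_cons; apply: beqU; first by apply: xyb; rewrite mem_head.
  by apply: IH => c cs; apply: xyb; rewrite in_cons cs orbT.
rewrite -(bs_glue_cst S JP Pinf x) -(bs_glue_cst S JP Pinf y).
rewrite -(bs_glue_ite S JP Pinf (fun=> x) (fun=> y)); congr bs_glue.
by apply/funext => p; apply: xy; exact: set_valP.
Qed.

Lemma bset_glue_exists P (x : B -> X) : X -> J P ->
  exists z, forall b, P b -> beq S b z (x b).
Proof.
move=> x0 JP; case: (pselect (finite_set P)) => [/finite_seqP[s Ps]|Pinf]; last first.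
  exists (bs_glue S JP Pinf (fun p => x (val p))) => b Pb.
  exact: (bs_ite_glue S JP Pinf (fun p => x (val p)) (SigSub (mem_set Pb))).
have [_ _ dis] := zd_part JP.
suff [z zP] : exists z, forall b, b \in s -> beq S b z (x b).
  by exists z => b; rewrite Ps => /zP.
have {Ps} : forall b, b \in s -> P b by move=> b; rewrite Ps.
elim: s => [|b s IH] sP; first by exists x0.
case: IH => [c cs|z zP]; first by apply: sP; rewrite in_cons cs orbT.
exists (bs_ite S b (x b) z) => c; have [-> _|cb] := eqVneq c b.
  exact: beq_iteT.
rewrite in_cons (negbTE cb) /= => cs; apply: beq_trans (zP _ cs).
apply: beq_le (beq_iteF b (x b) z); rewrite -disj_leC; apply/eqP; apply: dis.
- by apply: sP; rewrite in_cons cs orbT.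
- by apply: sP; rewrite mem_head.
- exact/eqP.
Qed.

Lemma beq_local c P x y : local_cov J c P ->
  (forall b, P b -> beq S b x y) -> beq S c x y.
Proof.
move=> [[_ [ub lub] _] [Q JQ PQ]] xy; rewrite /beq.
apply: (bset_glue_unique JQ) => b Qb.
have [Pb|nPb] := pselect (P b).
  apply: beq_trans (xy _ Pb); exact: beq_le (ub _ Pb) (beq_iteT c x y).
apply: beq_le (beq_iteF c x y).
rewrite -disj_leC meetC disj_leC; apply: lub => e Pe; rewrite -disj_leC; apply/eqP.
by have [_ _ dis] := zd_part JQ; apply: dis => //; [exact: PQ|move=> eb; apply: nPb; rewrite -eb].
Qed.

End BSetTheory.

Lemma local_cov_neq0 (J : zd_topology) c P : local_cov J c P -> c != \bot ->
  exists2 b, P b & b != \bot.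
Proof.
move=> [[P0 [_ lub] _] _] c0; have [[b Pb]|nP] := pselect (exists b, P b).
  by exists b => //; exact: P0.
suff /eqP : c = \bot by rewrite (negbTE c0).
by apply/eqP; rewrite -lex0; apply: lub => b Pb; case: nP; exists b.
Qed.

Definition nonzero := {b : B | b != \bot}.

End Topology.

Arguments zd_topology {d} B.
Arguments nonzero {d} B.

Record matched_pair (d : Order.disp_t) (B : ctbDistrLatticeType d)
    (M : monoidType) := MatchedPair {
  mp_top : zd_topology B;
  mp_bset : bset mp_top M;
  mp_pb : M -> B -> B;
  mp_nondeg : (\bot : B) <> \top;
  mp_pb_hom : forall m, grothendieck_hom mp_top (mp_pb m);
  mp_pb1 : forall b, mp_pb 1%g b = b;
  mp_pbM : forall m n b, mp_pb (m * n)%g b = mp_pb m (mp_pb n b);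
  mp_eqMl : forall b m n p,
    beq mp_bset b m n -> beq mp_bset b (m * p)%g (n * p)%g;
  mp_eqMr : forall b m n p,
    beq mp_bset b n p -> beq mp_bset (mp_pb m b) (m * n)%g (m * p)%g;
  mp_eq_pb : forall b c m n,
    beq mp_bset b m n -> b `&` mp_pb m c = b `&` mp_pb n c }.

Section MatchedPair.
Context {d : Order.disp_t} {B : ctbDistrLatticeType d} {M : monoidType}.
Variable G : matched_pair B M.
Local Notation J := (mp_top G).
Local Notation pb := (mp_pb G).
Implicit Types (m n p : M).

Record bm_set := BMSet {
  bm_car :> Type;
  bm_bset : bset J bm_car;
  bm_act : M -> bm_car -> bm_car;
  bm_act1 : forall x, bm_act 1%g x = x;
  bm_actM : forall m n x, bm_act (m * n)%g x = bm_act m (bm_act n x);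
  bm_eql : forall b m n x, beq (mp_bset G) b m n ->
    beq bm_bset b (bm_act m x) (bm_act n x);
  bm_eqr : forall b m x y, beq bm_bset b x y ->
    beq bm_bset (pb m b) (bm_act m x) (bm_act m y) }.

Record bm_hom (X Y : bm_set) := BMHom {
  bm_fun :> X -> Y;
  bm_fun_beq : forall b x y,
    beq (bm_bset X) b x y -> beq (bm_bset Y) b (bm_fun x) (bm_fun y);
  bm_fun_act : forall m x, bm_fun (bm_act m x) = bm_act m (bm_fun x) }.

Lemma bm_hom_ext (X Y : bm_set) (f g : bm_hom X Y) : f =1 g -> f = g.
Proof.
case: f g => [f f1 f2] [g g1 g2] /= /funext fg; case: g / fg g1 g2 => g1 g2.
by rewrite (Prop_irrelevance f1 g1) (Prop_irrelevance f2 g2).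
Qed.

Definition bm_id (X : bm_set) : bm_hom X X :=
  @BMHom X X id (fun _ _ _ h => h) (fun _ _ => erefl).

Program Definition bm_comp (X Y Z : bm_set) (g : bm_hom Y Z) (f : bm_hom X Y) :
  bm_hom X Z := @BMHom X Z (g \o f) _ _.
Next Obligation. by move=> * /=; do 2![apply: bm_fun_beq]. Qed.
Next Obligation. by move=> * /=; rewrite !bm_fun_act. Qed.

Program Definition BMSetCat : category :=
  @Category bm_set bm_hom bm_id bm_comp _ _ _.
Next Obligation. by move=> * /=; apply: bm_hom_ext. Qed.
Next Obligation. by move=> * /=; apply: bm_hom_ext. Qed.
Next Obligation. by move=> * /=; apply: bm_hom_ext. Qed.

(* Elements of X(b) and X(c) may only be compared as elements of the disjoint
   union of the fibres, e.g. when b and c are equal but not convertible. *)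
Definition same_elt (X : nonzero B -> Type) (b c : nonzero B)
  (x : X b) (y : X c) := existT X b x = existT X c y.

(* [ps_act m c h x] is m . x for x in X(c), where h witnesses pb m c != 0, and
   [ps_res b c h x] is b /\ x for x in X(c), where h witnesses b /\ c != 0. *)
Record presheaf := Presheaf {
  ps_car :> nonzero B -> Type;
  ps_act : forall m (c : nonzero B) (h : pb m (val c) != \bot),
    ps_car c -> ps_car (exist _ (pb m (val c)) h);
  ps_res : forall b (c : nonzero B) (h : b `&` val c != \bot),
    ps_car c -> ps_car (exist _ (b `&` val c) h);
  ps_resid : forall (c : nonzero B) h (x : ps_car c),
    same_elt (@ps_res (val c) c h x) x;
  ps_resI : forall a b (c : nonzero B) h h1 h2 (x : ps_car c),
    same_elt (@ps_res (a `&` b) c h x)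
             (@ps_res a (exist _ _ h1) h2 (@ps_res b c h1 x));
  ps_act1 : forall (c : nonzero B) h (x : ps_car c),
    same_elt (@ps_act 1%g c h x) x;
  ps_actM : forall m n (c : nonzero B) h h1 h2 (x : ps_car c),
    same_elt (@ps_act (m * n)%g c h x)
             (@ps_act m (exist _ _ h1) h2 (@ps_act n c h1 x));
  ps_act_res : forall m b (c : nonzero B) h1 h2 h3 h4 (x : ps_car c),
    same_elt (@ps_act m (exist _ (b `&` val c) h1) h2 (@ps_res b c h1 x))
             (@ps_res (pb m b) (exist _ (pb m (val c)) h3) h4 (@ps_act m c h3 x));
  ps_act_eq : forall b m n (c : nonzero B) h1 h2 h3 h4 (x : ps_car c),
    beq (mp_bset G) b m n ->
    same_elt (@ps_res b (exist _ (pb m (val c)) h1) h2 (@ps_act m c h1 x))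
             (@ps_res b (exist _ (pb n (val c)) h3) h4 (@ps_act n c h3 x)) }.
Arguments ps_act X m {c} h x : rename.
Arguments ps_res X b {c} h x : rename.

Definition matching (X : nonzero B -> Type) (P : set B) :=
  forall b : nonzero B, P (val b) -> X b.

(* In [sh_glueE] the family y is, up to transport along b /\ c = b, the family
   (b /\ x)_(b in P). *)
Record sheaf := Sheaf {
  sh_ps :> presheaf;
  sh_glue : forall (c : nonzero B) (P : set B),
    local_cov J (val c) P -> matching sh_ps P -> sh_ps c;
  sh_res_glue : forall (c : nonzero B) P (JP : local_cov J (val c) P)
      (x : matching sh_ps P) (b : nonzero B) (Pb : P (val b)) h,
    same_elt (ps_res sh_ps (val b) h (sh_glue JP x)) (x b Pb);
  sh_glueE : forall (c : nonzero B) P (JP : local_cov J (val c) P)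
      (x : sh_ps c) (y : matching sh_ps P),
    (forall (b : nonzero B) (Pb : P (val b)) h,
       same_elt (y b Pb) (ps_res sh_ps (val b) h x)) ->
    sh_glue JP y = x }.

Record ps_hom (X Y : presheaf) := PSHom {
  ps_fun :> forall c : nonzero B, X c -> Y c;
  ps_fun_act : forall m (c : nonzero B) h (x : X c),
    ps_fun (ps_act X m h x) = ps_act Y m h (ps_fun x);
  ps_fun_res : forall b (c : nonzero B) h (x : X c),
    ps_fun (ps_res X b h x) = ps_res Y b h (ps_fun x) }.

Lemma ps_hom_ext (X Y : presheaf) (f g : ps_hom X Y) :
  (forall (c : nonzero B) (x : X c), f c x = g c x) -> f = g.
Proof.
case: f g => [f f1 f2] [g g1 g2] /= fg.
have {}fg : f = g by apply: functional_extensionality_dep => c; apply/funext => x.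
case: g / fg g1 g2 => g1 g2.
by rewrite (Prop_irrelevance f1 g1) (Prop_irrelevance f2 g2).
Qed.

Definition ps_id (X : presheaf) : ps_hom X X :=
  @PSHom X X (fun _ x => x) (fun _ _ _ _ => erefl) (fun _ _ _ _ => erefl).

Program Definition ps_comp (X Y Z : presheaf) (g : ps_hom Y Z) (f : ps_hom X Y) :
  ps_hom X Z := @PSHom X Z (fun c x => g c (f c x)) _ _.
Next Obligation. by move=> * /=; rewrite !ps_fun_act. Qed.
Next Obligation. by move=> * /=; rewrite !ps_fun_res. Qed.

Program Definition BMShvCat : category :=
  @Category sheaf ps_hom (fun X => ps_id X)
    (fun _ _ _ g f => ps_comp g f) _ _ _.
Next Obligation. by move=> * /=; apply: ps_hom_ext. Qed.
Next Obligation. by move=> * /=; apply: ps_hom_ext. Qed.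
Next Obligation. by move=> * /=; apply: ps_hom_ext. Qed.

Lemma nonzero_eq (b c : nonzero B) : val b = val c -> b = c.
Proof. exact: val_inj. Qed.

Program Definition unit_ps : presheaf :=
  @Presheaf (fun=> unit) (fun _ _ _ _ => tt) (fun _ _ _ _ => tt) _ _ _ _ _ _.
Next Obligation.
by move=> c h []; congr existT; apply: nonzero_eq => /=; rewrite meetxx.
Qed.
Next Obligation.
by move=> * /=; congr existT; apply: nonzero_eq => /=; rewrite meetA.
Qed.
Next Obligation.
by move=> c h []; congr existT; apply: nonzero_eq => /=; rewrite mp_pb1.
Qed.
Next Obligation.
by move=> * /=; congr existT; apply: nonzero_eq => /=; rewrite mp_pbM.
Qed.
Next Obligation.
move=> m b c *; congr existT; apply: nonzero_eq => /=.
by have [[_ -> _ _] _] := mp_pb_hom G m.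
Qed.
Next Obligation.
by move=> b m n c *; congr existT; apply: nonzero_eq => /=; exact: mp_eq_pb.
Qed.

Program Definition unit_sheaf : sheaf :=
  @Sheaf unit_ps (fun _ _ _ _ => tt) _ _.
Next Obligation.
move=> c P [[_ [ub _] _] _] x b Pb h; rewrite /same_elt; case: (x b Pb).
by congr existT; apply: nonzero_eq => /=; apply/meet_idPl; exact: ub.
Qed.
Next Obligation. by move=> c P JP []. Qed.

Program Definition shv_one : terminal_object BMShvCat :=
  @TerminalObject BMShvCat unit_sheaf
    (fun X => @PSHom X unit_ps (fun _ _ => tt) _ _) _.
Next Obligation. by []. Qed.
Next Obligation. by []. Qed.
Next Obligation. by move=> X f; apply: ps_hom_ext => c x /=; case: (f c x). Qed.

Section Wedge.
Variable X : bm_set.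
Local Notation S := (bm_bset X).

(* X / ==_b, as the set of classes. *)
Definition wedge_car b := {A : set X | exists x, A = [set y | beq S b x y]%classic}.

(* The element b /\ x of X / ==_b. *)
Definition wedge b (x : X) : wedge_car b :=
  exist _ [set y | beq S b x y]%classic (ex_intro _ x erefl).

Definition wedge_rep b (q : wedge_car b) : X := sval (cid (svalP q)).

Lemma wedgeP b (q : wedge_car b) : wedge b (wedge_rep q) = q.
Proof.
case: q => A HA; rewrite /wedge /wedge_rep /=; case: cid => x /= xA.
by apply: eq_exist; rewrite -xA.
Qed.

Lemma eq_wedge b x y : wedge b x = wedge b y <-> beq S b x y.
Proof.
split=> [[] xy|xy].
  have : [set z | beq S b y z]%classic y by exact: beq_refl.
  by rewrite -xy.
apply: eq_exist; apply/funext => z; apply/propext; split=> /= h.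
  by apply: beq_trans h; exact: beq_sym.
exact: beq_trans h.
Qed.

Lemma wedge_repK b x : beq S b (wedge_rep (wedge b x)) x.
Proof. by apply/eq_wedge; rewrite wedgeP. Qed.

Definition wedge_act m (c : nonzero B) (h : pb m (val c) != \bot)
  (q : wedge_car (val c)) : wedge_car (pb m (val c)) :=
  wedge (pb m (val c)) (bm_act m (wedge_rep q)).

Definition wedge_res b (c : nonzero B) (h : b `&` val c != \bot)
  (q : wedge_car (val c)) : wedge_car (b `&` val c) :=
  wedge (b `&` val c) (wedge_rep q).

Lemma wedge_actE m c h x :
  @wedge_act m c h (wedge (val c) x) = wedge (pb m (val c)) (bm_act m x).
Proof. by apply/eq_wedge; apply: bm_eqr; exact: wedge_repK. Qed.

Lemma wedge_resE b c h x :
  @wedge_res b c h (wedge (val c) x) = wedge (b `&` val c) x.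
Proof. by apply/eq_wedge; apply: beq_le (wedge_repK _ _); exact: leIr. Qed.

Lemma wedge_same (b c : nonzero B) x y : val b = val c -> beq S (val b) x y ->
  @same_elt (fun c => wedge_car (val c)) b c (wedge (val b) x) (wedge (val c) y).
Proof. by move=> /nonzero_eq <- xy; congr existT; apply/eq_wedge. Qed.


Lemma wedge_sameP (b c : nonzero B) x y :
  @same_elt (fun c => wedge_car (val c)) b c (wedge (val b) x) (wedge (val c) y) ->
  beq S (val b) x y.
Proof.
move=> xy; have bc : b = c := congr1 (@projT1 _ _) xy.
case: c / bc xy => xy; have := projT2_eq xy.
by rewrite (Prop_irrelevance (projT1_eq xy) erefl) => /eq_wedge.
Qed.

Lemma wedge_glue_exists (c : nonzero B) P : local_cov J (val c) P ->
  forall q : matching (fun b : nonzero B => wedge_car (val b)) P,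
  exists z, forall (b : nonzero B) (Pb : P (val b)), q b Pb = wedge (val b) z.
Proof.
move=> Pc q; have [b0 Pb0 nb0] := local_cov_neq0 Pc (valP c).
pose x b : X := if pselect (b != \bot) is left nb then
  if pselect (P b) is left Pb then wedge_rep (q (exist _ b nb) Pb)
  else wedge_rep (q (exist _ b0 nb0) Pb0) else wedge_rep (q (exist _ b0 nb0) Pb0).
have [_ [Q JQ PQ]] := Pc.
have [z zx] := bset_glue_exists S x (x b0) JQ.
exists z => -[b nb] Pb; have := zx _ (PQ _ Pb); rewrite /x /=.
case: pselect => // nb'; case: pselect => // Pb'.
rewrite (Prop_irrelevance nb' nb) (Prop_irrelevance Pb' Pb) => zb.
by rewrite -(wedgeP (q _ _)); apply/eq_wedge; exact: beq_sym.
Qed.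

Program Definition wedge_ps : presheaf :=
  @Presheaf (fun b : nonzero B => wedge_car (val b)) wedge_act wedge_res
    _ _ _ _ _ _.
Next Obligation.
move=> c h q; rewrite -(wedgeP q) wedge_resE.
apply: (@wedge_same (exist _ _ _)); first exact: meetxx.
exact: beq_refl.
Qed.
Next Obligation.
move=> a b c h h1 h2 q; rewrite -(wedgeP q) !wedge_resE.
apply: (@wedge_same (exist _ _ _) (exist _ _ _)); first by rewrite /= meetA.
exact: beq_refl.
Qed.
Next Obligation.
move=> c h q; rewrite -(wedgeP q) wedge_actE bm_act1.
apply: (@wedge_same (exist _ _ _)); first exact: mp_pb1.
exact: beq_refl.
Qed.
Next Obligation.
move=> m n c h h1 h2 q; rewrite -(wedgeP q) !wedge_actE.
rewrite bm_actM.
apply: (@wedge_same (exist _ _ _) (exist _ _ _)); first exact: mp_pbM.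
exact: beq_refl.
Qed.
Next Obligation.
move=> m b c h1 h2 h3 h4 q; rewrite -(wedgeP q) wedge_actE wedge_resE.
rewrite [X in same_elt _ X](@wedge_resE _ (exist _ _ h3)).
rewrite [X in same_elt X](@wedge_actE _ (exist _ _ h1)).
apply: (@wedge_same (exist _ _ _) (exist _ _ _)) => /=.
  by have [[_ -> _ _] _] := mp_pb_hom G m.
exact: beq_refl.
Qed.
Next Obligation.
move=> b m n c h1 h2 h3 h4 q mn; rewrite -(wedgeP q) !wedge_actE.
rewrite [X in same_elt X](@wedge_resE _ (exist _ _ h1)).
rewrite [X in same_elt _ X](@wedge_resE _ (exist _ _ h3)).
apply: (@wedge_same (exist _ _ _) (exist _ _ _)) => /=.
  exact: mp_eq_pb.
by apply: beq_le (bm_eql _ mn); exact: leIl.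
Qed.

Definition wedge_glue_rep (c : nonzero B) P (Pc : local_cov J (val c) P)
    (q : matching (fun b : nonzero B => wedge_car (val b)) P) : X :=
  sval (cid (wedge_glue_exists Pc q)).

Lemma wedge_glueP (c : nonzero B) P (Pc : local_cov J (val c) P) q
    (b : nonzero B) (Pb : P (val b)) :
  q b Pb = wedge (val b) (wedge_glue_rep Pc q).
Proof. exact: (svalP (cid (wedge_glue_exists Pc q))). Qed.

Program Definition wedge_sheaf : sheaf :=
  @Sheaf wedge_ps (fun c P Pc q => wedge (val c) (wedge_glue_rep Pc q)) _ _.
Next Obligation.
move=> c P Pc q b Pb h /=; rewrite (wedge_glueP Pc q Pb) wedge_resE.
apply: (@wedge_same (exist _ _ _)); last exact: beq_refl.
by apply/meet_idPl; have [[_ [ub _] _] _] := Pc; exact: ub.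
Qed.
Next Obligation.
move=> c P Pc q y yq /=.
rewrite -(wedgeP q); apply/eq_wedge; apply: beq_local (Pc) _ => b Pb.
have [[P0 [ub _] _] _] := Pc; pose b' : nonzero B := exist _ b (P0 _ Pb).
have h : val b' `&` val c != \bot by rewrite (meet_idPl (ub _ Pb)) (P0 _ Pb).
have := yq b' Pb h; rewrite (@wedge_glueP _ _ Pc y b' Pb) -{1}(wedgeP q) /= wedge_resE.
refine (@wedge_sameP b' (exist _ (val b' `&` val c) h) (wedge_glue_rep Pc y) (wedge_rep q)).
Qed.

End Wedge.
Arguments wedge X b x : clear implicits.

Program Definition wedge_hom (X Y : bm_set) (f : bm_hom X Y) :
    ps_hom (wedge_ps X) (wedge_ps Y) :=
  @PSHom (wedge_ps X) (wedge_ps Y)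
    (fun c q => wedge Y (val c) (f (wedge_rep q))) _ _.
Next Obligation.
move=> X Y f m c h q /=; rewrite wedge_actE -bm_fun_act; apply/eq_wedge.
by apply: bm_fun_beq; exact: wedge_repK.
Qed.
Next Obligation.
move=> X Y f b c h q /=; rewrite wedge_resE; apply/eq_wedge.
by apply: bm_fun_beq; exact: wedge_repK.
Qed.

Lemma wedge_homE (X Y : bm_set) (f : bm_hom X Y) (c : nonzero B) x :
  wedge_hom f c (wedge X (val c) x) = wedge Y (val c) (f x).
Proof. by apply/eq_wedge; apply: bm_fun_beq; exact: wedge_repK. Qed.

Program Definition wedge_functor : functor BMSetCat BMShvCat :=
  @Functor BMSetCat BMShvCat wedge_sheaf wedge_hom _ _.
Next Obligation. by move=> X; apply: ps_hom_ext => c q /=; rewrite wedgeP. Qed.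
Next Obligation.
move=> X Y Z g f; apply: ps_hom_ext => c q /=; apply/eq_wedge.
by apply: bm_fun_beq; apply: beq_sym; exact: wedge_repK.
Qed.

End MatchedPair.

(* Main.v *)
Require Import Defs.
From mathcomp Require Import all_boot all_order.
From mathcomp Require Import generic_quotient.
From mathcomp Require Import boolp classical_sets functions cardinality.

Set Implicit Arguments.
Unset Strict Implicit.
Unset Printing Implicit Defensive.

Import Order.Theory.
Local Open Scope order_scope.
Local Obligation Tactic := idtac.

(** The functor sends an algebra X to the sheaf of its quotients X/==_b, and
    its inverse sends a sheaf Y to its set of global sections Y(1).

    A sheaf map between B /\ X and B /\ X' is determined by its component at 1,
    where ==_1 is equality, and any such component preserves every ==_b because
    it commutes with restriction; hence the functor is full and faithful
    ([wedge_full], [wedge_faithful]).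

    For every sheaf Y the set Y(1) is an algebra, with x ==_b y meaning that x
    and y have the same restriction to b: existence and uniqueness of glueings
    in Y are exactly what makes these relations define a B_J-set
    ([bset_of_eqv], [global_sections]).  Sending the class of x modulo ==_b to
    its restriction to b gives a map [counit] from B /\ Y(1) to Y, which is
    injective by construction.  It is surjective as soon as Y(1) has one
    element x0, for then an element of Y(c) extends to 1 by glueing it with the
    restriction of x0 to the complement of c ([restr_surj]).  So Y is in the
    image of the functor provided that Y(1) is inhabited whenever some Y(c) is,
    and everything reduces to proving this when Y is two-valued.

    To that end, call I a J-ideal of B if it is a down-set containing 0, stable
    under every m^*, and such that z is in I as soon as p /\ z is in I for all p
    in some P in J.  Then B/I, with x ==_b y iff b meets the symmetric
    difference of x and y in an element of I, is an algebra ([quot_set]):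
    glueing works because {p /\ a_p, p /\ a_p' : p in P} is again in J, so that
    the join of the p /\ a_p exists ([cov_mix]).  The classes of 0 and 1 are
    fixed by M, so they give two maps from the terminal sheaf to B /\ (B/I), and
    these agree over c exactly when c is in I ([const_point_eq]).
    - If Y is well-supported, take for I the set of c such that c = 0 or Y(c)
      is inhabited.  The two maps agree after composition with Y -> 1, hence
      are equal, so 1 is in I ([well_supported_top]).
    - If Y is initial, take I = {0}.  The two composites from Y are equal, so
      no Y(c) is inhabited ([initial_fibres]). *)

(** * Equivalences of categories *)

Lemma full_faithful_equivalence (C D : category) (F : functor C D) :
  full F -> faithful F ->
  (forall y : D, exists (x : C) (f : hom (F x) y), is_iso f) ->
  is_equivalence F.
Proof.
move=> fullF faithF surjF; have [G0 G0P] := choice surjF.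
pose eps y : hom (F (G0 y)) y := sval (cid (G0P y)).
have epsP y : is_iso (eps y) by exact: svalP (cid (G0P y)).
pose inv y : hom y (F (G0 y)) := sval (cid (epsP y)).
have invK y : Defs.comp (inv y) (eps y) = idm _.
  by have [] := svalP (cid (epsP y)).
have epsK y : Defs.comp (eps y) (inv y) = idm _.
  by have [] := svalP (cid (epsP y)).
pose lift x x' (g : hom (F x) (F x')) : hom x x' := sval (cid (fullF _ _ g)).
have liftE x x' (g : hom (F x) (F x')) : fmap F (lift x x' g) = g.
  exact: svalP (cid (fullF _ _ g)).
pose G1 y z (g : hom y z) : hom (G0 y) (G0 z) :=
  lift _ _ (Defs.comp (inv z) (Defs.comp g (eps y))).
have G1id y : G1 _ _ (idm y) = idm (G0 y).
  by apply: faithF; rewrite liftE fmap1 comp1m invK.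
have G1comp x y z (g : hom y z) (f : hom x y) :
    G1 _ _ (Defs.comp g f) = Defs.comp (G1 _ _ g) (G1 _ _ f).
  apply: faithF; rewrite fmapM !liftE -!Defs.compA.
  congr Defs.comp; congr Defs.comp.
  by rewrite !Defs.compA epsK comp1m.
exists (@Functor D C G0 G1 G1id G1comp); split.
  exists (fun x => lift _ _ (eps (F x))); split=> [x y f|x].
    by apply: faithF; rewrite /= !fmapM !liftE Defs.compA epsK comp1m.
  exists (lift _ _ (inv (F x))).
  by split; apply: faithF; rewrite fmapM !liftE ?invK ?epsK fmap1.
exists eps; split=> [x y f|x]; last exact: epsP.
by rewrite /= liftE Defs.compA epsK comp1m.
Qed.

(** * Partitions of a zero-dimensional topology *)

Section Partitions.
Context {d : Order.disp_t} {B : ctbDistrLatticeType d}.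
Variable J : zd_topology B.
Implicit Types (a b c z : B) (P D : set B).

(** The partition {b, b'}; removing 0 makes it one for b = 0 and b = 1 too. *)
Definition pair_part b : set B := minus0 [set b; (~` b)%O]%classic.

Lemma pair_part_cov b : J (pair_part b).
Proof.
apply: zd_fin; last first.
  by apply: (@sub_finite_set _ _ [set b; (~` b)%O]%classic) => // c [].
split=> [c []|| ] //.
  split=> [c _|u ub]; first exact: lex1.
  have leu c : [set b; (~` b)%O]%classic c -> c <= u.
    by have [->|c0 bc] := eqVneq c \bot; [rewrite le0x|apply: ub].
  by rewrite -(joinxC b) leUx !leu //; [right|left].
by move=> c e [[->|->] _] [[->|->] _] // _; rewrite ?meetxC // meetC meetxC.
Qed.

Lemma leI_shift b x y : (b `&` x <= y) = (x <= ~` b `|` y).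
Proof. by rewrite -leBLR diffE complK meetC. Qed.

(** An inequality may be checked on each block of a partition, since meeting
    with z distributes over the join of the blocks. *)
Lemma cov_le P z a : J P -> (forall p, P p -> p `&` z <= a) -> z <= a.
Proof.
move=> JP Pza; have [_ [_ lub] _] := zd_part JP.
have /lub : ubound P (~` z `|` a) by move=> p /Pza; rewrite meetC leI_shift.
by rewrite -leI_shift meetx1.
Qed.

Lemma cov_disj P p q : J P -> P p -> P q -> p <> q -> q <= ~` p.
Proof.
move=> JP Pp Pq pq; have [_ _ dis] := zd_part JP.
by rewrite -disj_leC meetC dis.
Qed.

(** Meeting the blocks of P with z gives part of the common refinement of P
    and {z, z'}, which is again in J. *)
Lemma local_cov_meet P z : J P ->
  local_cov J z (minus0 (refinement P (fun=> [set z]%classic))).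
Proof.
move=> JP; split; last first.
  exists (minus0 (refinement P (fun=> pair_part z))).
    by apply: zd_refine => // p _; exact: pair_part_cov.
  move=> _ [[p [_ [Pp ->] ->]] pz0]; split=> //; exists p; exists z => //.
  split=> //; split; first by left.
  by apply: contraNneq pz0 => ->; rewrite meetx0.
have [_ _ dis] := zd_part JP; split=> [c []|| ] //.
  split=> [_ [[p [_ [_ ->] ->]] _]|u ub]; first exact: leIr.
  apply: (cov_le JP) => p Pp.
  have [->|pz0] := eqVneq (p `&` z) \bot; first exact: le0x.
  by apply: ub; split=> //; exists p; exists z.
move=> _ _ [[p [_ [Pp ->] ->]] _] [[q [_ [Pq ->] ->]] _] pq.
by rewrite meetACA (dis p q) ?meet0x // => e; apply: pq; rewrite e.
Qed.

(** Sorting the blocks of P according to D is a map onto a set with at most two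
    elements, so coarsening P along it provides the join. *)
Lemma cov_sup P D : J P -> exists z, supremums (P `&` D)%classic z.
Proof.
move=> JP; pose alpha (p : P) := `[< D (val p) >].
(* The blocks may all lie on one side, so bool is cut down to the image. *)
pose I := {i : bool | exists p, alpha p = i}.
pose beta p : I := exist _ (alpha p) (ex_intro _ p erefl).
have [|s [sP _]] := @zd_coarsen _ _ J P I beta JP.
  by move=> [i [p pi]]; exists p; apply: eq_exist.
have [iT|niT] := pselect (exists p, alpha p = true).
  exists (s (exist _ true iT)); have := sP (exist _ true iT).
  congr supremums; apply/seteqP; split=> [_ [p [/asboolP Dp] ->]|b [Pb Db]].
    by split=> //; exact: set_valP.
  exists (SigSub (mem_set Pb)) => //; apply: eq_exist; exact/asboolP.
exists \bot; split=> [b [Pb Db]|u _]; last exact: le0x.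
by case: niT; exists (SigSub (mem_set Pb)); apply/asboolP.
Qed.

(** Elements of B glue along P: the glueing is the join of the p /\ a_p, which
    exists because these are the blocks on one side of the partition
    {p /\ a_p, p /\ a_p' : p in P}. *)
Lemma cov_mix P (a : B -> B) : J P ->
  exists z, forall p, P p -> p `&` z = p `&` a p.
Proof.
move=> JP; pose R := minus0 (refinement P (fun p => pair_part (a p))).
have JR : J R by apply: zd_refine => // p _; exact: pair_part_cov.
have [z [ub lub]] :=
  cov_sup [set r | exists2 p, P p & (r <= p `&` a p)%O]%classic JR.
exists z => p Pp; apply/eqP; rewrite eq_le !lexI !leIl /= leI_shift.
apply/andP; split.
  apply: lub => r [_ [q Pq rq]]; rewrite -leI_shift.
  have [pq|pq] := pselect (p = q).
    by apply: le_trans (leIr _ _) _; apply: le_trans rq _; rewrite pq leIr.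
  rewrite leI_shift; apply: le_trans (leUl _ _); apply: le_trans rq _.
  by apply: le_trans (leIl _ _) (cov_disj JP Pp Pq pq).
have [->|pa0] := eqVneq (p `&` a p) \bot; first exact: le0x.
apply: ub; split; last by exists p.
split=> //; exists p; exists (a p) => //; split=> //; split; first by left.
by apply: contraNneq pa0 => ->; rewrite meetx0.
Qed.

End Partitions.

(** * Algebras over B from compatible equivalence relations *)

Section BSetOfEquivalences.
Context {d : Order.disp_t} {B : ctbDistrLatticeType d}.
Variables (J : zd_topology B) (X : Type) (e : B -> X -> X -> Prop).
Hypothesis e_refl : forall b x, e b x x.
Hypothesis e_sym : forall b x y, e b x y -> e b y x.
Hypothesis e_trans : forall b x y z, e b x y -> e b y z -> e b x z.
Hypothesis e_le : forall b c x y, c <= b -> e b x y -> e c x y.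
Hypothesis e0 : forall x y, e \bot x y.
Hypothesis e_glue : forall (P : set B) (x : P -> X), J P ->
  exists z, forall p : P, e (val p) z (x p).
Hypothesis e_uniq : forall (P : set B) x y, J P ->
  (forall p, P p -> e p x y) -> x = y.

(** Agreement on b and on b' is agreement on the blocks of a partition in J;
    in [eqv_uniq3] the partition is the common refinement of {b, b'} and
    {c, c'}. *)
Lemma eqv_uniq2 b x y : e b x y -> e (~` b) x y -> x = y.
Proof.
by move=> xy xy'; apply: (e_uniq (pair_part_cov J b)) => c [[->|->] _].
Qed.

Lemma eqv_uniq3 b c x y : e (b `&` c) x y -> e (b `&` ~` c) x y ->
  e (~` b) x y -> x = y.
Proof.
move=> xy1 xy2 xy3.
pose R := minus0 (refinement (pair_part b) (fun=> pair_part c)).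
have JR : J R by apply: zd_refine => [|p _]; exact: pair_part_cov.
apply: (e_uniq JR) => _ [[p [q [[[->|->] _] [[->|->] _]] ->]] _] //.
  exact: e_le (leIl _ _) xy3.
exact: e_le (leIl _ _) xy3.
Qed.

(** The element b(x,y) glues x on b and y on b'. *)
Lemma eqv_ite_exists b x y : exists z, e b z x /\ e (~` b) z y.
Proof.
have [z zP] := e_glue (fun p : pair_part b => if val p == b then x else y)
  (pair_part_cov J b).
exists z; split.
  have [->|b0] := eqVneq b \bot; first exact: e0.
  have Pb : pair_part b b by split=> //; left.
  by have := zP (SigSub (mem_set Pb)); rewrite /= eqxx.
have [->|b0] := eqVneq (~` b) \bot; first exact: e0.
have Pb : pair_part b (~` b) by split=> //; right.
have := zP (SigSub (mem_set Pb)); rewrite /=; case: eqP => // bb.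
(* b' = b forces b' = b' /\ b = 0. *)
suff : ~` b == \bot by rewrite (negbTE b0).
by rewrite -[X in X == _]meetxx {1}bb meetxC.
Qed.

Definition eqv_ite b x y : X := sval (cid (eqv_ite_exists b x y)).

Lemma eqv_iteT b x y : e b (eqv_ite b x y) x.
Proof. by have [] := svalP (cid (eqv_ite_exists b x y)). Qed.

Lemma eqv_iteF b x y : e (~` b) (eqv_ite b x y) y.
Proof. by have [] := svalP (cid (eqv_ite_exists b x y)). Qed.

Definition eqv_glue P (JP : J P) (Pinf : infinite_set P) (x : P -> X) : X :=
  sval (cid (e_glue x JP)).

Lemma eqv_glueP P (JP : J P) (Pinf : infinite_set P) (x : P -> X) (p : P) :
  e (val p) (eqv_glue JP Pinf x) (x p).
Proof. exact: (svalP (cid (e_glue x JP))). Qed.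

Lemma eqv_iteP b x y z : e b z x -> e (~` b) z y -> eqv_ite b x y = z.
Proof.
move=> zx zy; apply: (@eqv_uniq2 b).
  exact: e_trans (eqv_iteT _ _ _) (e_sym zx).
exact: e_trans (eqv_iteF _ _ _) (e_sym zy).
Qed.

Lemma eqv_iteE b x y : eqv_ite b x y = y <-> e b x y.
Proof.
split=> [xy|xy]; last exact: eqv_iteP (e_sym xy) (e_refl _ _).
by apply: e_sym; rewrite -{1}xy; exact: eqv_iteT.
Qed.

Lemma eqv_glue_eq P (JP : J P) (Pinf : infinite_set P) (x : P -> X) z :
  (forall p : P, e (val p) (x p) z) -> eqv_glue JP Pinf x = z.
Proof.
move=> xz; apply: (e_uniq JP) => p Pp.
by have := xz (SigSub (mem_set Pp)); apply: e_trans; exact: eqv_glueP.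
Qed.

(** Each equation holds because both sides agree on every block of a suitable
    partition. *)
Program Definition bset_of_eqv : bset J X :=
  @BSet d B J X eqv_ite _ _ _ _ _ _ eqv_glue _ _ _.
Next Obligation. by move=> b x; apply: eqv_iteP; exact: e_refl. Qed.
Next Obligation.
move=> b x y z; apply: eqv_iteP (eqv_iteF _ _ _).
exact: e_trans (eqv_iteT _ _ _) (e_sym (eqv_iteT _ _ _)).
Qed.
Next Obligation.
move=> b x y z; apply: eqv_iteP (eqv_iteT _ _ _) _.
exact: e_trans (eqv_iteF _ _ _) (e_sym (eqv_iteF _ _ _)).
Qed.
Next Obligation.
by move=> x y; apply: eqv_iteP (e_refl _ _) _; rewrite compl1; exact: e0.
Qed.
Next Obligation.
move=> b x y; apply: eqv_iteP (eqv_iteF _ _ _) _.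
by rewrite complK; exact: eqv_iteT.
Qed.
Next Obligation.
move=> b c x y; set w := eqv_ite c x y; set v := eqv_ite b w y.
have vw : e b v w by exact: eqv_iteT.
have vy : e (~` b) v y by exact: eqv_iteF.
have ub : e (~` (b `&` c)) (eqv_ite (b `&` c) x y) y by exact: eqv_iteF.
apply: (@eqv_uniq3 b c).
- apply: e_trans (eqv_iteT _ _ _) (e_sym _).
  apply: e_trans (e_le (leIl _ _) vw) _; apply: e_le (leIr _ _) _.
  exact: eqv_iteT.
- apply: (@e_trans _ _ y).
    by apply: e_le ub; rewrite complI; apply: le_trans (leIr _ _) (leUr _ _).
  apply: e_sym; apply: e_trans (e_le (leIl _ _) vw) _; apply: e_le (leIr _ _) _.
  exact: eqv_iteF.
- apply: e_trans (e_sym vy).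
  by apply: e_le ub; rewrite complI; exact: leUl.
Qed.
Next Obligation.
by move=> P JP Pinf x; apply: eqv_glue_eq => p; exact: e_refl.
Qed.
Next Obligation.
move=> P JP Pinf x y; apply: eqv_glue_eq => p.
exact: e_trans (eqv_iteT _ _ _) (e_sym (eqv_glueP _ _ _ _)).
Qed.
Next Obligation.
by move=> P JP Pinf x p; apply/eqv_iteE; exact: eqv_glueP.
Qed.

Lemma beq_of_eqv b x y : beq bset_of_eqv b x y <-> e b x y.
Proof. exact: eqv_iteE. Qed.

End BSetOfEquivalences.

(** * Elements of presheaf fibres *)

#[local] Arguments ps_act {d B M G} Y m {c} h x : rename.
#[local] Arguments ps_res {d B M G} Y b {c} h x : rename.
#[local] Arguments wedge {d B M G} X b x.

Section MatchedPairs.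
Context {d : Order.disp_t} {B : ctbDistrLatticeType d} {M : monoidType}.
Variable G : matched_pair B M.
Local Notation J := (mp_top G).
Local Notation pb := (mp_pb G).
Local Notation nz h := (exist (fun b : B => is_true (b != \bot)) _ h).
Implicit Types (m n : M) (a b : B).

Lemma pb0 m : pb m \bot = \bot. Proof. by have [[[]]] := mp_pb_hom G m. Qed.
Lemma pbT m : pb m \top = \top. Proof. by have [[[]]] := mp_pb_hom G m. Qed.
Lemma pbI m a b : pb m (a `&` b) = pb m a `&` pb m b.
Proof. by have [[]] := mp_pb_hom G m. Qed.
Lemma pbC m a : pb m (~` a) = ~` pb m a.
Proof. by have [[]] := mp_pb_hom G m. Qed.
Lemma top_neq0 : (\top : B) != \bot.
Proof. by rewrite eq_sym; apply/eqP; exact: (mp_nondeg G). Qed.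

Section SameElt.
Variable X : nonzero B -> Type.

Lemma same_elt_eq (c : nonzero B) (x y : X c) : same_elt x y -> x = y.
Proof.
move=> xy; have := projT2_eq xy.
by rewrite (Prop_irrelevance (projT1_eq xy) erefl).
Qed.

Definition transport (b c : nonzero B) (bc : val b = val c) (x : X b) : X c :=
  eq_rect b X x c (nonzero_eq bc).

Lemma transport_same (b c : nonzero B) (bc : val b = val c) (x : X b) :
  same_elt (transport bc x) x.
Proof.
by rewrite /transport; move: (nonzero_eq bc) => bc'; case: c / bc' bc.
Qed.

Lemma same_trans (a b c : nonzero B) (x : X a) (y : X b) (z : X c) :
  same_elt x y -> same_elt y z -> same_elt x z.
Proof. exact: etrans. Qed.

Lemma same_sym (a b : nonzero B) (x : X a) (y : X b) :
  same_elt x y -> same_elt y x.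
Proof. exact: esym. Qed.

End SameElt.

(** [same_elt] is equality across fibres; these congruences let it be used like
    equality where the indices are provably but not definitionally equal. *)
Lemma fun_same (X Y : nonzero B -> Type) (f : forall c : nonzero B, X c -> Y c)
  (b c : nonzero B) (x : X b) (y : X c) :
  same_elt x y -> same_elt (f b x) (f c y).
Proof.
move=> xy; have bc : b = c := congr1 (@projT1 _ _) xy.
case: c / bc y xy => y xy; by rewrite (same_elt_eq xy).
Qed.

Lemma res_same (Y : presheaf G) a (b c : nonzero B) h1 h2 (x : Y b) (y : Y c) :
  same_elt x y -> same_elt (ps_res Y a h1 x) (ps_res Y a h2 y).
Proof.
move=> xy; have bc : b = c := congr1 (@projT1 _ _) xy.
case: c / bc h2 y xy => h2 y xy; rewrite (same_elt_eq xy).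
by rewrite (Prop_irrelevance h1 h2).
Qed.

Lemma act_same (Y : presheaf G) m (b c : nonzero B) h1 h2 (x : Y b) (y : Y c) :
  same_elt x y -> same_elt (ps_act Y m h1 x) (ps_act Y m h2 y).
Proof.
move=> xy; have bc : b = c := congr1 (@projT1 _ _) xy.
case: c / bc h2 y xy => h2 y xy; rewrite (same_elt_eq xy).
by rewrite (Prop_irrelevance h1 h2).
Qed.

Definition nz_top : nonzero B := exist _ \top top_neq0.

(** * Global sections of a sheaf *)

Section GlobalSections.
Variable Y : sheaf G.
Implicit Types x y z : Y nz_top.

Fact restr_neq0 (c : nonzero B) : val c `&` val nz_top != \bot.
Proof. by rewrite meetx1 (valP c). Qed.

(** Restriction of a global section to c, moved from the index c /\ 1 to c. *)
Definition restr (c : nonzero B) x : Y c :=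
  transport (meetx1 (val c) : val (nz (restr_neq0 c)) = val c)
    (ps_res Y (val c) (restr_neq0 c) x).

Lemma restr_res (c : nonzero B) x h :
  same_elt (restr c x) (ps_res Y (val c) h x).
Proof.
apply: same_trans (transport_same _ _) _.
by rewrite (Prop_irrelevance h (restr_neq0 c)).
Qed.

Lemma res_restr b (c : nonzero B) h x :
  ps_res Y b h (restr c x) = restr (nz h) x.
Proof.
apply: same_elt_eq; apply: same_sym.
have h2 : b `&` val (nz (restr_neq0 c)) != \bot.
  by rewrite /= meetx1.
have h3 : (b `&` val c) `&` val nz_top != \bot by rewrite meetx1.
have s1 := @ps_resI _ _ _ _ Y b (val c) nz_top h3 (restr_neq0 c) h2 x.
apply: same_trans (@restr_res (nz h) x h3) (same_trans s1 _).
by apply: res_same; apply: same_sym; exact: restr_res.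
Qed.

Lemma restr_le (b c : nonzero B) x y : val b <= val c ->
  restr c x = restr c y -> restr b x = restr b y.
Proof.
move=> /meet_idPl bc xy.
have h : val b `&` val c != \bot by rewrite bc (valP b).
have -> : b = nz h by apply: nonzero_eq; rewrite /= bc.
by rewrite -!res_restr xy.
Qed.

Fact act_top_neq0 m : pb m (val nz_top) != \bot.
Proof. by rewrite pbT top_neq0. Qed.

(** M acts on Y(1) because m^* 1 = 1. *)
Definition global_act m x : Y nz_top :=
  transport (pbT m : val (nz (act_top_neq0 m)) = val nz_top)
    (ps_act Y m (act_top_neq0 m) x).

Lemma global_actP m h x : same_elt (global_act m x) (ps_act Y m h x).
Proof.
apply: same_trans (transport_same _ _) _.
by rewrite (Prop_irrelevance h (act_top_neq0 m)).
Qed.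

Lemma act_restr m (c : nonzero B) h x :
  ps_act Y m h (restr c x) = restr (nz h) (global_act m x).
Proof.
apply: same_elt_eq.
have h2 : pb m (val (nz (restr_neq0 c))) != \bot.
  by rewrite /= meetx1.
have s1 := act_same h h2 (restr_res x (restr_neq0 c)).
apply: same_trans s1 _.
have h4 : pb m (val c) `&` val (nz (act_top_neq0 m)) != \bot.
  by rewrite /= pbT meetx1.
have s2 := @ps_act_res _ _ _ _ Y m (val c) nz_top _ h2 (act_top_neq0 m) h4 x.
apply: same_trans s2 _; apply: same_sym.
apply: same_trans (@restr_res (nz h) _ (restr_neq0 (nz h))) _.
by apply: res_same; exact: global_actP.
Qed.

(** Vacuous for b = 0, where Y has no fibre; this is what makes ==_0 total. *)
Definition restr_eq b x y :=
  forall h : b != \bot, restr (nz h) x = restr (nz h) y.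

Lemma restr_eqP (c : nonzero B) x y :
  restr_eq (val c) x y <-> restr c x = restr c y.
Proof.
case: c => c hc /=; split=> [|xy h]; first exact.
by rewrite (Prop_irrelevance h hc).
Qed.

Lemma restr_eq_refl b x : restr_eq b x x.
Proof. by []. Qed.

Lemma restr_eq_sym b x y : restr_eq b x y -> restr_eq b y x.
Proof. by move=> xy h. Qed.

Lemma restr_eq_trans b x y z :
  restr_eq b x y -> restr_eq b y z -> restr_eq b x z.
Proof. by move=> xy yz h; rewrite xy. Qed.

Lemma restr_eq_le b c x y : c <= b -> restr_eq b x y -> restr_eq c x y.
Proof.
move=> cb xy h; have b0 : b != \bot.
  by apply: contraNneq h => b0; move: cb; rewrite b0 lex0.
exact: (@restr_le (nz h) (nz b0) x y cb (xy b0)).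
Qed.

Lemma restr_eq0 x y : restr_eq \bot x y.
Proof. by move=> h; have := h; rewrite eqxx. Qed.

Lemma local_cov_top P : J P -> local_cov J (val nz_top) P.
Proof. by move=> JP; split; [exact: zd_part JP|exists P]. Qed.

Lemma glue_global P (JP : J P) (y : matching Y P) :
  exists z : Y nz_top,
    forall (b : nonzero B) (Pb : P (val b)), restr b z = y b Pb.
Proof.
exists (sh_glue (local_cov_top JP) y) => b Pb; apply: same_elt_eq.
apply: same_trans (restr_res _ (restr_neq0 _)) _; exact: sh_res_glue.
Qed.

Lemma restr_eq_glue (P : set B) (x : P -> Y nz_top) : J P ->
  exists z, forall p : P, restr_eq (val p) z (x p).
Proof.
move=> JP; have [z zx] := glue_global JP
  (fun (b : nonzero B) Pb => restr b (x (SigSub (mem_set Pb)))).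
exists z => p h; rewrite (zx (nz h) (set_valP p)).
by congr (restr _ (x _)); exact: val_inj.
Qed.

(** By the second sheaf axiom both x and y are the glueing of the restrictions
    of x to the blocks of P. *)
Lemma restr_eq_uniq (P : set B) x y : J P ->
  (forall p, P p -> restr_eq p x y) -> x = y.
Proof.
move=> JP xy; pose f : matching Y P := fun (b : nonzero B) Pb => restr b x.
transitivity (sh_glue (local_cov_top JP) f); [apply: esym|]; apply: sh_glueE.
  by move=> b Pb h; exact: restr_res.
by move=> b Pb h; rewrite /f (restr_eqP b x y).1; [exact: restr_res|exact: xy].
Qed.

Definition global_bset : bset J (Y nz_top) :=
  bset_of_eqv restr_eq_refl restr_eq_sym restr_eq_trans restr_eq_le restr_eq0
    restr_eq_glue restr_eq_uniq.

Lemma global_beq b x y : beq global_bset b x y <-> restr_eq b x y.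
Proof. exact: beq_of_eqv. Qed.

Program Definition global_sections : bm_set G :=
  @BMSet d B M G (Y nz_top) global_bset global_act _ _ _ _.
Next Obligation.
move=> x; apply: (@same_elt_eq Y nz_top).
have s1 := global_actP (act_top_neq0 1%g) x.
have s2 := ps_act1 (act_top_neq0 1%g) x.
exact: same_trans s1 s2.
Qed.
Next Obligation.
move=> m n x; apply: (@same_elt_eq Y nz_top).
apply: same_trans (global_actP (act_top_neq0 _) x) _.
have h2 : pb m (val (nz (act_top_neq0 n))) != \bot.
  by rewrite /= !pbT top_neq0.
have s2 := @ps_actM _ _ _ _ Y m n nz_top (act_top_neq0 _) _ h2 x.
apply: same_trans s2 _.
apply: same_sym; apply: same_trans (global_actP (act_top_neq0 _) _) _.
by apply: act_same; exact: global_actP.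
Qed.
Next Obligation.
move=> b m n x mn; apply/global_beq => h.
have key k : same_elt (restr (nz h) (global_act k x))
    (ps_res Y b (c := nz (act_top_neq0 k))
       (eq_ind_r (fun t => b `&` t != \bot) (restr_neq0 (nz h)) (pbT k))
       (ps_act Y k (act_top_neq0 k) x)).
  apply: same_trans (restr_res _ (restr_neq0 _)) _.
  by apply: res_same; exact: global_actP.
apply: (@same_elt_eq Y (nz h)); apply: same_trans (key m) _.
apply: same_trans (same_sym (key n)).
exact: ps_act_eq.
Qed.
Next Obligation.
move=> b m x y /global_beq xy; apply/global_beq => h.
have b0 : b != \bot by apply: contraNneq h => ->; rewrite pb0.
by rewrite -!(@act_restr m (nz b0)) xy.
Qed.

Lemma restr_rep (c : nonzero B) x :
  restr c (wedge_rep (wedge global_sections (val c) x)) = restr c x.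
Proof.
by apply/restr_eqP/global_beq; exact: (@wedge_repK _ _ _ _ global_sections).
Qed.

(** Two representatives of a class modulo ==_c have the same restriction to c,
    by definition of ==_c on Y(1). *)
Program Definition counit : ps_hom (wedge_sheaf global_sections) Y :=
  @PSHom d B M G (wedge_sheaf global_sections) Y
    (fun (c : nonzero B) q => restr c (wedge_rep q)) _ _.
Next Obligation.
by move=> m c h q; rewrite [RHS]act_restr; exact: (@restr_rep (nz h)).
Qed.
Next Obligation.
by move=> b c h q; rewrite [RHS]res_restr; exact: (@restr_rep (nz h)).
Qed.

Lemma counit_inj (c : nonzero B) : injective (counit c).
Proof.
move=> q r /restr_eqP/global_beq; rewrite -{2}(wedgeP q) -{2}(wedgeP r).
by move=> /(@eq_wedge _ _ _ _ global_sections).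
Qed.

(** Glue y on c with the restriction of x0 on c'. *)
Lemma restr_surj (c : nonzero B) x0 (y : Y c) : exists x, restr c x = y.
Proof.
pose f : matching Y (pair_part (val c)) := fun (b : nonzero B) _ =>
  if pselect (c = b) is left cb then eq_rect c Y y b cb else restr b x0.
have [x xf] := glue_global (pair_part_cov J (val c)) f.
have Pc : pair_part (val c) (val c) by split; [left|exact: (valP c)].
exists x; rewrite (xf c Pc) /f; case: pselect => // cc.
by rewrite (Prop_irrelevance cc erefl).
Qed.

Lemma counit_surj : (forall c : nonzero B, Y c -> inhabited (Y nz_top)) ->
  forall (c : nonzero B) (y : Y c), exists q, counit c q = y.
Proof.
move=> Y1 c y; have [x0] := Y1 c y; have [x <-] := restr_surj x0 y.
by exists (wedge global_sections (val c) x); exact: restr_rep.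
Qed.

End GlobalSections.

Lemma ps_hom_iso (X Y : sheaf G) (f : ps_hom X Y) :
  (forall c : nonzero B, injective (f c)) ->
  (forall (c : nonzero B) (y : Y c), exists x, f c x = y) ->
  @is_iso (BMShvCat G) X Y f.
Proof.
move=> finj fsurj; pose g (c : nonzero B) y := sval (cid (fsurj c y)).
have fg (c : nonzero B) (y : Y c) : f c (g c y) = y.
  exact: svalP (cid (fsurj c y)).
have g_act m (c : nonzero B) h (y : Y c) :
    g _ (ps_act Y m h y) = ps_act X m h (g c y).
  by apply: finj; rewrite fg ps_fun_act fg.
have g_res b (c : nonzero B) h (y : Y c) :
    g _ (ps_res Y b h y) = ps_res X b h (g c y).
  by apply: finj; rewrite fg ps_fun_res fg.
exists (PSHom g_act g_res); split; apply: ps_hom_ext => c x /=; last exact: fg.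
by apply: finj; rewrite fg.
Qed.

Lemma counit_iso (Y : sheaf G) :
  (forall c : nonzero B, Y c -> inhabited (Y nz_top)) ->
  @is_iso (BMShvCat G) (wedge_sheaf (global_sections Y)) Y (counit Y).
Proof.
by move=> Y1; apply: ps_hom_iso; [exact: counit_inj|exact: counit_surj].
Qed.

(** * Fullness, faithfulness and two-valuedness of the functor *)

(** The component of g at 1 is a map X -> Y, as ==_1 is equality.  It preserves
    ==_b because g commutes with restriction from 1 to b. *)
Lemma wedge_full : full (wedge_functor G).
Proof.
move=> X Y /= g.
pose f x := wedge_rep (g nz_top (wedge X (val nz_top) x)).
have fE b (h : b != \bot) x :
    g (nz h) (wedge X b x) = wedge Y b (f x).
  have ht : b `&` val nz_top != \bot by rewrite meetx1.
  have r1 : ps_res (wedge_ps Y) b ht (g nz_top (wedge X (val nz_top) x)) =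
      wedge Y (b `&` val nz_top) (f x).
    by rewrite -[g nz_top _]wedgeP; exact: (@wedge_resE _ _ _ _ Y b nz_top ht).
  have r2 : ps_res (wedge_ps X) b ht (wedge X (val nz_top) x) =
      wedge X (b `&` val nz_top) x.
    exact: (@wedge_resE _ _ _ _ X b nz_top ht).
  have := ps_fun_res g ht (wedge X (val nz_top) x); rewrite r1 r2 => r3.
  apply: (@same_elt_eq (wedge_ps Y) (nz h)).
  have s1 : @same_elt _ _ (wedge_ps X) (nz h) (nz ht) (wedge X b x)
      (wedge X (b `&` val nz_top) x).
    apply: (@wedge_same _ _ _ _ X (nz h) (nz ht)); last exact: beq_refl.
    by rewrite /= meetx1.
  apply: same_trans (fun_same g s1) _; rewrite r3.
  apply: (@wedge_same _ _ _ _ Y (nz ht) (nz h)); last exact: beq_refl.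
  by rewrite /= meetx1.
have feq b x y : beq (bm_bset X) b x y -> beq (bm_bset Y) b (f x) (f y).
  have [->|b0 xy] := eqVneq b \bot; first by move=> _; exact: beq0.
  apply/eq_wedge; rewrite -!(fE b b0); by have /eq_wedge -> := xy.
have fact m x : f (bm_act m x) = bm_act m (f x).
  have hm : pb m (val nz_top) != \bot by rewrite pbT top_neq0.
  apply: (@beq1 _ _ _ _ (bm_bset Y)).
  rewrite -[X in beq _ X](pbT m); apply/eq_wedge.
  have r1 : ps_act (wedge_ps Y) m hm (g nz_top (wedge X (val nz_top) x)) =
      wedge Y (pb m (val nz_top)) (bm_act m (f x)).
    by rewrite -[g nz_top _]wedgeP; exact: (@wedge_actE _ _ _ _ Y m nz_top hm).
  have r2 : ps_act (wedge_ps X) m hm (wedge X (val nz_top) x) =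
      wedge X (pb m (val nz_top)) (bm_act m x).
    exact: (@wedge_actE _ _ _ _ X m nz_top hm).
  by rewrite -(fE _ hm) -r1 -r2; exact: (ps_fun_act g hm).
exists (BMHom feq fact); apply: ps_hom_ext => -[c hc] q /=.
by rewrite -[in RHS](wedgeP q) -fE.
Qed.

Lemma wedge_faithful : faithful (wedge_functor G).
Proof.
move=> X Y f g fg; apply: bm_hom_ext => x; apply: (@beq1 _ _ _ _ (bm_bset Y)).
apply/eq_wedge; rewrite -(wedge_homE f nz_top) -(wedge_homE g nz_top).
by rewrite [wedge_hom f]fg.
Qed.

(** A map out of the terminal sheaf is determined over c by its value at the
    image of any element of X(c). *)
Lemma well_supported_inhabited (X : sheaf G) :
  (forall c : nonzero B, inhabited (X c)) -> well_supported (shv_one G) X.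
Proof.
move=> Xi Z g h gh; apply: ps_hom_ext => c [].
have [x] := Xi c; exact: (congr1 (fun k : ps_hom X Z => k c x) gh).
Qed.

Lemma initial_empty (X : sheaf G) :
  (forall c : nonzero B, X c -> False) -> @is_initial (BMShvCat G) X.
Proof.
move=> X0 Z.
exists (@PSHom d B M G X Z (fun (c : nonzero B) x => False_rect _ (X0 c x))
  (fun _ (c : nonzero B) _ x => False_ind _ (X0 c x))
  (fun _ (c : nonzero B) _ x => False_ind _ (X0 c x))).
by move=> g; apply: ps_hom_ext => c x; case: (X0 c x).
Qed.

Lemma wedge_two_valued (X : bm_set G) :
  two_valued (shv_one G) (wedge_functor G X).
Proof.
have [[x]|X0] := pselect (inhabited X); [right|left].
  by apply: well_supported_inhabited => c; exists; exact: (wedge X (val c) x).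
by apply: initial_empty => c q; apply: X0; exists; exact: wedge_rep q.
Qed.

(** * The quotient of B by a J-ideal *)

Section IdealQuotient.
Variable I : B -> Prop.
Hypothesis I0 : I \bot.
Hypothesis I_le : forall a b, a <= b -> I b -> I a.
Hypothesis I_local : forall (P : set B) z, J P ->
  (forall p, P p -> I (p `&` z)) -> I z.
Hypothesis I_pb : forall m b, I b -> I (pb m b).

(** Along {a, a'} the join of a and b is locally below a or below b. *)
Lemma ideal_join a b : I a -> I b -> I (a `|` b).
Proof.
move=> Ia Ib; apply: (I_local (pair_part_cov J a)) => p [[->|->] _].
  by apply: I_le Ia; exact: leIl.
by apply: I_le Ib; rewrite leI_shift complK.
Qed.

(** The order of B, restricted to b and taken modulo I. *)
Definition below b x y := I (b `&` (x `&` ~` y)).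

Lemma below_trans b x y z : below b x y -> below b y z -> below b x z.
Proof.
move=> xy yz; apply: I_le (ideal_join xy yz).
rewrite -meetUr leI2 //.
(* Split x /\ z' along y: the part under y is below y /\ z', the rest below
   x /\ y'. *)
rewrite -[leLHS]meetx1 -(joinxC y) meetUr leUx; apply/andP; split.
  apply: le_trans (leUr _ _).
  by rewrite lexI leIr (le_trans (leIl _ _) (leIr _ _)).
apply: le_trans (leUl _ _).
by rewrite lexI leIr (le_trans (leIl _ _) (leIl _ _)).
Qed.

Definition equal_on b x y := below b x y /\ below b y x.

Lemma equal_on_meet b x y : b `&` x = b `&` y -> equal_on b x y.
Proof.
move=> xy; split; rewrite /below meetA; [rewrite xy|rewrite -xy];
  by rewrite -meetA meetxC meetx0.
Qed.

Lemma equal_on_refl b x : equal_on b x x.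
Proof. exact: equal_on_meet. Qed.

Lemma equal_on_sym b x y : equal_on b x y -> equal_on b y x.
Proof. by case. Qed.

Lemma equal_on_trans b x y z :
  equal_on b x y -> equal_on b y z -> equal_on b x z.
Proof.
by move=> [xy yx] [yz zy]; split; [exact: below_trans yz|exact: below_trans yx].
Qed.

Lemma equal_on_le b c x y : c <= b -> equal_on b x y -> equal_on c x y.
Proof.
by move=> cb [xy yx]; split; [apply: I_le xy|apply: I_le yx]; exact: leI2.
Qed.

Lemma equal_on_pb m b x y :
  equal_on b x y -> equal_on (pb m b) (pb m x) (pb m y).
Proof. by move=> [xy yx]; split; rewrite /below -pbC -!pbI; exact: I_pb. Qed.

Definition quot_rel : rel B := fun x y => `[< equal_on \top x y >].

Lemma quot_rel_equiv : equiv_class_of quot_rel.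
Proof.
split=> [x|x y|y x z]; rewrite /quot_rel.
- by apply/asboolP; exact: equal_on_refl.
- by apply/asboolP/asboolP; exact: equal_on_sym.
- by move=> /asboolP xy /asboolP yz; apply/asboolP; exact: equal_on_trans xy yz.
Qed.

Definition quot_equiv : equiv_rel B := EquivRelPack quot_rel_equiv.
Definition quot := {eq_quot quot_equiv}%qT.
Definition cls (x : B) : quot := (\pi x)%qT.
Definition rep (q : quot) : B := repr q.

Lemma rep_cls b x : equal_on b (rep (cls x)) x.
Proof.
apply: (@equal_on_le \top); first exact: lex1.
by apply/asboolP; apply/(@eqmodP _ quot_equiv); rewrite reprK.
Qed.

Lemma eq_cls x y : equal_on \top x y -> cls x = cls y.
Proof. by move=> xy; apply/(@eqmodP _ quot_equiv)/asboolP. Qed.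

Definition quot_eq b (q r : quot) := equal_on b (rep q) (rep r).

Lemma quot_eq_cls b x y : quot_eq b (cls x) (cls y) <-> equal_on b x y.
Proof.
have [xx yy] := (rep_cls b x, rep_cls b y); split=> xy.
  exact: equal_on_trans (equal_on_sym xx) (equal_on_trans xy yy).
exact: equal_on_trans xx (equal_on_trans xy (equal_on_sym yy)).
Qed.

Lemma quot_eq0 q r : quot_eq \bot q r.
Proof. by apply: equal_on_meet; rewrite !meet0x. Qed.

(** Representatives are glued in B itself. *)
Lemma quot_eq_glue (P : set B) (x : P -> quot) : J P ->
  exists z, forall p : P, quot_eq (val p) z (x p).
Proof.
move=> JP; pose a b := if pselect (P b) is left Pb
  then rep (x (SigSub (mem_set Pb))) else \bot.
have [z za] := cov_mix a JP; exists (cls z) => p.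
apply: equal_on_trans (rep_cls _ _) _; apply: equal_on_meet.
rewrite za; last exact: set_valP.
congr Order.meet; rewrite /a; case: pselect => [Pp|[]]; last exact: set_valP.
by congr (rep (x _)); exact: val_inj.
Qed.

Lemma quot_eq_uniq (P : set B) q r : J P ->
  (forall p, P p -> quot_eq p q r) -> q = r.
Proof.
move=> JP qr; rewrite -[q]reprK -[r]reprK; apply: eq_cls.
by split; apply: (I_local JP) => p Pp; rewrite meet1x; have [] := qr p Pp.
Qed.

Definition quot_bset : bset J quot :=
  @bset_of_eqv _ _ J quot quot_eq (fun b q => equal_on_refl b (rep q))
    (fun b q r => @equal_on_sym b (rep q) (rep r))
    (fun b q r s => @equal_on_trans b (rep q) (rep r) (rep s))
    (fun b c q r => @equal_on_le b c (rep q) (rep r))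
    quot_eq0 quot_eq_glue quot_eq_uniq.

Lemma quot_beq b q r : beq quot_bset b q r <-> quot_eq b q r.
Proof. exact: beq_of_eqv. Qed.

Definition quot_act m q := cls (pb m (rep q)).

(** The action is by m^*; if m ==_b n, then m^* x and n^* x agree on b already
    in B, by the axioms of a matched pair. *)
Program Definition quot_set : bm_set G :=
  @BMSet d B M G quot quot_bset quot_act _ _ _ _.
Next Obligation. by move=> q; rewrite /quot_act mp_pb1; exact: reprK. Qed.
Next Obligation.
move=> m n q; apply: eq_cls; rewrite mp_pbM -[X in equal_on X](pbT m).
by apply: equal_on_pb; apply: equal_on_sym; exact: rep_cls.
Qed.
Next Obligation.
move=> b m n q mn; apply/quot_beq/quot_eq_cls; apply: equal_on_meet.
exact: mp_eq_pb.
Qed.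
Next Obligation.
move=> b m q r /quot_beq qr; apply/quot_beq/quot_eq_cls; exact: equal_on_pb.
Qed.

Lemma act_cls m x : pb m x = x -> bm_act m (cls x : quot_set) = cls x.
Proof.
move=> xE; apply: eq_cls.
rewrite -[X in equal_on _ _ X]xE -[X in equal_on X](pbT m).
by apply: equal_on_pb; exact: rep_cls.
Qed.

(** An M-invariant element of an algebra is a global point of its sheaf. *)
Program Definition const_point (x : B) (xE : forall m, pb m x = x) :
  ps_hom (unit_sheaf G) (wedge_sheaf quot_set) :=
  @PSHom d B M G (unit_sheaf G) (wedge_sheaf quot_set)
    (fun (c : nonzero B) _ => wedge quot_set (val c) (cls x)) _ _.
Next Obligation. by move=> x xE m c h u; rewrite /= wedge_actE act_cls. Qed.
Next Obligation. by move=> x xE b c h u; rewrite /= wedge_resE. Qed.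

(** The symmetric difference of 0 and 1 is 1, so their classes agree on c
    exactly when c is in I. *)
Lemma const_point_eq (c : nonzero B) :
  const_point pb0 c tt = const_point pbT c tt <-> I (val c).
Proof.
apply: (iff_trans (@eq_wedge _ _ _ _ quot_set (val c) (cls \bot) (cls \top))).
apply: (iff_trans (quot_beq _ _ _)); apply: (iff_trans (quot_eq_cls _ _ _)).
rewrite /equal_on /below compl0 !meetx1 meet0x meetx0.
by split=> [[]|].
Qed.

End IdealQuotient.

(** * Two-valued sheaves *)

(** With I = {0} the two points of the quotient sheaf differ over every c, yet
    they become equal on Y because a map out of Y is unique. *)
Lemma initial_fibres (Y : sheaf G) : @is_initial (BMShvCat G) Y ->
  forall c : nonzero B, Y c -> False.
Proof.
move=> Yi c y; pose I b := b = \bot :> B.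
have I_le a b : a <= b -> I b -> I a.
  by move=> ab b0; apply/eqP; rewrite -lex0 -b0.
have I_local (P : set B) z : J P -> (forall p, P p -> I (p `&` z)) -> I z.
  move=> JP Pz; apply/eqP; rewrite -lex0; apply: (cov_le JP) => p Pp.
  by rewrite (Pz p Pp).
have I_pb m b : I b -> I (pb m b) by move=> ->; exact: pb0.
pose Z := wedge_sheaf (quot_set erefl I_le I_local I_pb).
have [f fP] := Yi Z.
pose k x xE : ps_hom Y Z :=
  ps_comp (@const_point I erefl I_le I_local I_pb x xE) (to_one (shv_one G) Y).
have kk : k _ pb0 = k _ pbT by rewrite (fP (k _ pb0)) (fP (k _ pbT)).
have /const_point_eq c0 := congr1 (fun k : ps_hom Y Z => k c y) kk.
by move/eqP: (valP c); apply.
Qed.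

(** The support of Y, together with 0, is a J-ideal: restriction makes it a
    down-set, the action makes it stable under m^*, and glueing makes it local.
    The two points of its quotient sheaf agree on the support, hence are equal
    as Y -> 1 is epi, and so the support contains 1. *)
Lemma well_supported_top (Y : sheaf G) : well_supported (shv_one G) Y ->
  inhabited (Y nz_top).
Proof.
move=> Yw; pose I b := forall h : b != \bot, inhabited (Y (nz h)).
have I0 : I \bot by move=> h; have := h; rewrite eqxx.
have I_le a b : a <= b -> I b -> I a.
  move=> /meet_idPl ab Ib h; have b0 : b != \bot.
    by apply: contraNneq h => b0; rewrite -ab b0 meetx0.
  have h' : a `&` val (nz b0) != \bot by rewrite /= ab.
  have [y] := Ib b0; exists; apply: transport (ps_res Y a h' y).
  exact: ab.
have I_pb m b : I b -> I (pb m b).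
  move=> Ib h; have b0 : b != \bot by apply: contraNneq h => ->; rewrite pb0.
  by have [y] := Ib b0; exists; exact: (@ps_act _ _ _ _ Y m (nz b0) h y).
have I_local (P : set B) z : J P -> (forall p, P p -> I (p `&` z)) -> I z.
  move=> JP Pz h; have Jz := local_cov_meet z JP.
  exists; apply: (@sh_glue _ _ _ _ Y (nz h) _ Jz) => -[b b0] Pb.
  apply: inhabited_witness; case: Pb => -[p [_ [Pp ->] bE]] _.
  by have := Pz p Pp; rewrite -bE; apply.
pose Z := wedge_sheaf (quot_set I0 I_le I_local I_pb).
have : @const_point I I0 I_le I_local I_pb _ pb0 =
    const_point I0 I_le I_local I_pb pbT.
  apply: Yw; apply: ps_hom_ext => -[c c0] y; apply/const_point_eq => h.
  by rewrite (Prop_irrelevance h c0).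
move=> /(congr1 (fun k : ps_hom (unit_sheaf G) Z => k nz_top tt)).
by move=> /const_point_eq; apply.
Qed.

Lemma two_valued_top (Y : sheaf G) : two_valued (shv_one G) Y ->
  forall c : nonzero B, Y c -> inhabited (Y nz_top).
Proof.
move=> [Yi c y|Yw _ _]; last exact: well_supported_top.
by case: (initial_fibres Yi y).
Qed.

End MatchedPairs.

Theorem proposition4p5 (d : Order.disp_t) (B : ctbDistrLatticeType d)
    (M : monoidType) (G : matched_pair B M) :
  full (wedge_functor G) /\ faithful (wedge_functor G) /\
  exists two_valued_wedge : forall X : BMSetCat G,
      two_valued (shv_one G) (wedge_functor G X),
    is_equivalence
      (corestrict two_valued_wedge
        : functor (BMSetCat G) (two_valued_collapse (shv_one G))).
Proof.
split; first exact: wedge_full; split; first exact: wedge_faithful.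
exists (@wedge_two_valued _ _ _ G); apply: full_faithful_equivalence.
- by move=> X Y g; exact: wedge_full.
- by move=> X Y f g; exact: wedge_faithful.
move=> [Y Y2]; exists (global_sections Y), (counit Y).
exact: counit_iso (two_valued_top Y2).
Qed.
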